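(* Let $\mathbf{k}$ be a field of characteristic $0$. For a (possibly infinite dimensional) vector space $V$ over $\mathbf{k}$, factor algebras of $\mathrm{Sym}(V)$ with chosen Gorenstein duality are in bijection with formal polynomial series on $V$.
   Context: $\mathrm{Sym}(V)$ is the symmetric algebra of $V$. For a commutative $\mathbf{k}$-algebra $A$ with identity, a linear function $\ell\colon A\to\mathbf{k}$ defines a symmetric bilinear pairing $\langle a,b\rangle_\ell=\ell(ab)$ on $A$; this pairing is called a Gorenstein duality if it is non-degenerate. A factor algebra of $\mathrm{Sym}(V)$ is a quotient of $\mathrm{Sym}(V)$ by an ideal, and a factor algebra with chosen Gorenstein duality is such a quotient $A$ together with a linear function $\ell\colon A\to\mathbf{k}$ for which $\langle\cdot,\cdot\rangle_\ell$ is non-degenerate. The algebras are not assumed to be Artinian. A function $f\colon V\to\mathbf{k}$ is a homogeneous polynomial of degree $d$ if its restriction to every finite dimensional vector subspace of $V$ is a homogeneous polynomial of degree $d$. A formal polynomial series on $V$ is a formal sum $f=f_0+f_1+\ldots+f_i+\ldots$, where $f_i\colon V\to\mathbf{k}$ is a homogeneous polynomial of degree $i$. *)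

(* Defs.v *)
From HB Require Import structures.
From mathcomp Require Import all_boot all_algebra finmap.
From mathcomp Require Import generic_quotient ring_quotient.
From mathcomp Require Import boolp.
From mathcomp.multinomials Require mpoly.

Set Implicit Arguments.
Unset Strict Implicit.
Unset Printing Implicit Defensive.

Import GRing.Theory.
Local Open Scope ring_scope.
Local Open Scope quotient_scope.

Section HomogeneousPolynomials.
Import mpoly.
Variables (k : fieldType) (V : lmodType k).

(* The independent families [e] are the bases of the finite dimensional
   subspaces of V, and [p] is the restriction of f in the coordinates of [e].
   The zero polynomial is homogeneous of every degree. *)
Definition homogeneous_polynomial (d : nat) (f : V -> k) : Prop :=
  forall (n : nat) (e : 'I_n -> V),
    (forall c : 'I_n -> k, \sum_i c i *: e i = 0 -> forall i, c i = 0) ->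
    exists2 p : {mpoly k[n]}, p \is d.-homog
      & forall x : 'I_n -> k, f (\sum_i x i *: e i) = p.@[x].

(* The formal sum f_0 + f_1 + ... is the sequence of its components. *)
Record formal_series := FormalSeries {
  component :> nat -> V -> k;
  componentP : forall i, homogeneous_polynomial i (component i)
}.

End HomogeneousPolynomials.

(* The ideals of [ring_quotient] are proper.  Here the unit ideal must be
   allowed: the zero algebra with the zero function is a factor algebra with
   Gorenstein duality.  Boolean membership is no restriction, since [boolp]
   makes every proposition decidable. *)
Record ideal (A : comNzRingType) := Ideal {
  ideal_pred :> A -> bool;
  ideal0 : ideal_pred 0;
  idealD : forall u v, ideal_pred u -> ideal_pred v -> ideal_pred (u + v);
  idealM : forall a u, ideal_pred u -> ideal_pred (a * u)
}.

Section IdealClosed.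
Variables (A : comNzRingType) (I : ideal A).

Lemma ideal_zmod_closed : zmod_closed (ideal_pred I).
Proof.
split=> [|u v Iu Iv]; first exact: ideal0.
by apply: idealD => //; rewrite -mulN1r; apply: idealM.
Qed.

HB.instance Definition _ := GRing.isZmodClosed.Build A (ideal_pred I)
  ideal_zmod_closed.

Definition ideal_zmod : zmodClosed A := GRing.ZmodClosed.clone A (ideal_pred I) _.

End IdealClosed.

Section GeneratedIdeal.
Variables (A : comNzRingType) (G : A -> Prop).

Definition ideal_gen_pred (x : A) : bool :=
  `[< forall I : ideal A, (forall r, G r -> I r) -> I x >].

Lemma ideal_gen0 : ideal_gen_pred 0.
Proof. by apply/asboolP => I _; apply: ideal0. Qed.

Lemma ideal_genD u v :
  ideal_gen_pred u -> ideal_gen_pred v -> ideal_gen_pred (u + v).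
Proof.
move=> /asboolP Iu /asboolP Iv; apply/asboolP => I GI.
by apply: idealD; [apply: Iu | apply: Iv].
Qed.

Lemma ideal_genM a u : ideal_gen_pred u -> ideal_gen_pred (a * u).
Proof.
by move=> /asboolP Iu; apply/asboolP => I GI; apply/idealM/Iu.
Qed.

Definition ideal_gen : ideal A := Ideal ideal_gen0 ideal_genD ideal_genM.

Lemma ideal_gen_sub r : G r -> ideal_gen r.
Proof. by move=> Gr; apply/asboolP => I; apply. Qed.

Lemma ideal_gen_min (I : ideal A) :
  (forall r, G r -> I r) -> forall x, ideal_gen x -> I x.
Proof. by move=> GI x /asboolP; apply. Qed.

End GeneratedIdeal.

(* The quotient may be the zero ring, so it is not an [algType]: it is a
   [comPzRingType] and an [lmodType k] satisfying [fquot_scaleAl]. *)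
Section FactorAlgebra.
Variables (k : fieldType) (A : comAlgType k) (I : ideal A).

Definition fquot : Type := {ideal_quot ideal_zmod I}.

HB.instance Definition _ := Choice.on fquot.
HB.instance Definition _ := GRing.Zmodule.on fquot.

Definition fproj (a : A) : fquot := \pi_({ideal_quot ideal_zmod I}) a.

Lemma fproj_surj (x : fquot) : {a | x = fproj a}.
Proof. by exists (repr (x : {ideal_quot ideal_zmod I})); rewrite /fproj reprK. Qed.

Lemma fproj_eq a b : (fproj a = fproj b) <-> I (a - b).
Proof.
have -> : I (a - b) = (a == b %[mod {ideal_quot ideal_zmod I}]).
  by rewrite -Quotient.idealrBE.
by rewrite /fproj; split=> /eqP.
Qed.

Lemma fproj0 : fproj 0 = 0.
Proof. exact: (raddf0 \pi_({ideal_quot ideal_zmod I})). Qed.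

Lemma fprojD : {morph fproj : a b / a + b}.
Proof. exact: (raddfD \pi_({ideal_quot ideal_zmod I})). Qed.

Lemma fprojB : {morph fproj : a b / a - b}.
Proof. exact: (raddfB \pi_({ideal_quot ideal_zmod I})). Qed.

Definition fquot_lift (T : Type) (f : A -> T) (x : fquot) : T :=
  f (repr (x : {ideal_quot ideal_zmod I})).

Lemma fquot_liftE T (f : A -> T) :
  (forall a b, I (a - b) -> f a = f b) ->
  forall a, fquot_lift f (fproj a) = f a.
Proof. by move=> fI a; apply/fI/fproj_eq; rewrite /fproj reprK. Qed.

Definition fquot_one : fquot := fproj 1.

Definition fquot_mul (x y : fquot) : fquot :=
  fquot_lift (fun a => fquot_lift (fun b => fproj (a * b)) y) x.

Definition fquot_scale (c : k) (x : fquot) : fquot :=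
  fquot_lift (fun a => fproj (c *: a)) x.

Lemma fquot_mulE a b : fquot_mul (fproj a) (fproj b) = fproj (a * b).
Proof.
have E u v w : I (v - w) -> fproj (u * v) = fproj (u * w).
  by move=> Ivw; apply/fproj_eq; rewrite -mulrBr; apply: idealM.
rewrite /fquot_mul fquot_liftE ?fquot_liftE //; first exact: E.
move=> u v Iuv; rewrite /fquot_lift; set w := repr _.
by rewrite mulrC [v * w]mulrC; apply: E.
Qed.

Lemma fquot_scaleE c a : fquot_scale c (fproj a) = fproj (c *: a).
Proof.
rewrite /fquot_scale fquot_liftE // => u v Iuv; apply/fproj_eq.
by rewrite -scalerBr -mulr_algl; apply: idealM.
Qed.

Fact fquot_mulA : associative fquot_mul.
Proof.
move=> x y z; have [a ->] := fproj_surj x; have [b ->] := fproj_surj y.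
by have [c ->] := fproj_surj z; rewrite !fquot_mulE mulrA.
Qed.

Fact fquot_mulC : commutative fquot_mul.
Proof.
move=> x y; have [a ->] := fproj_surj x; have [b ->] := fproj_surj y.
by rewrite !fquot_mulE mulrC.
Qed.

Fact fquot_mul1 : left_id fquot_one fquot_mul.
Proof. by move=> x; have [a ->] := fproj_surj x; rewrite fquot_mulE mul1r. Qed.

Fact fquot_mulDl : left_distributive fquot_mul +%R.
Proof.
move=> x y z; have [a ->] := fproj_surj x; have [b ->] := fproj_surj y.
have [c ->] := fproj_surj z.
by rewrite -fprojD !fquot_mulE -fprojD mulrDl.
Qed.

HB.instance Definition _ := GRing.Zmodule_isComPzRing.Build fquot
  fquot_mulA fquot_mulC fquot_mul1 fquot_mulDl.

Fact fquot_scaleA c d x : fquot_scale c (fquot_scale d x) = fquot_scale (c * d) x.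
Proof. by have [a ->] := fproj_surj x; rewrite !fquot_scaleE scalerA. Qed.

Fact fquot_scale1 : left_id 1 fquot_scale.
Proof. by move=> x; have [a ->] := fproj_surj x; rewrite fquot_scaleE scale1r. Qed.

Fact fquot_scaleDr : right_distributive fquot_scale +%R.
Proof.
move=> c x y; have [a ->] := fproj_surj x; have [b ->] := fproj_surj y.
by rewrite -fprojD !fquot_scaleE -fprojD scalerDr.
Qed.

Fact fquot_scaleDl x : {morph fquot_scale^~ x : c d / c + d}.
Proof.
by move=> c d; have [a ->] := fproj_surj x; rewrite !fquot_scaleE -fprojD scalerDl.
Qed.

HB.instance Definition _ := GRing.Zmodule_isLmodule.Build k fquot
  fquot_scaleA fquot_scale1 fquot_scaleDr fquot_scaleDl.

Lemma fprojM : {morph fproj : a b / a * b}.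
Proof. by move=> a b; rewrite -fquot_mulE. Qed.

Lemma fproj1 : fproj 1 = 1. Proof. by []. Qed.

Lemma fprojX n : {morph fproj : a / a ^+ n}.
Proof.
by move=> a; elim: n => [|n IHn]; rewrite ?expr0 ?fproj1 // !exprS fprojM IHn.
Qed.

Lemma fprojZ c : {morph fproj : a / c *: a}.
Proof. by move=> a; rewrite -fquot_scaleE. Qed.

Lemma fquot_scaleAl (c : k) (x y : fquot) : c *: (x * y) = (c *: x) * y.
Proof.
have [a ->] := fproj_surj x; have [b ->] := fproj_surj y.
by rewrite -fprojM -!fprojZ -fprojM scalerAl.
Qed.

End FactorAlgebra.

From mathcomp.multinomials Require Import monalg.

(* Sym(V) is the free commutative k-algebra on the set V modulo the relations
   [c v + w] = c [v] + [w]; [sym_universal] below is its universal property. *)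
Definition freealg (k : fieldType) (V : lmodType k) : Type :=
  {malg k[{cmonom V}]}.

HB.instance Definition _ (k : fieldType) (V : lmodType k) :=
  GRing.ComAlgebra.on (freealg V).

HB.lock Definition freegen (k : fieldType) (V : lmodType k) (v : V) : freealg V :=
  << ucm v >>.

Section SymmetricAlgebra.
Variables (k : fieldType) (V : lmodType k).
Local Notation freealg := (freealg V).

Definition linear_relation (r : freealg) : Prop :=
  exists (c : k) (v w : V),
    r = freegen (c *: v + w) - (c *: freegen v + freegen w).

Definition sym : Type := fquot (ideal_gen linear_relation).

Definition sym_in (v : V) : sym := fproj _ (freegen v).

HB.instance Definition _ := GRing.ComPzRing.on sym.
HB.instance Definition _ := GRing.Lmodule.on sym.

Section FreeLift.
Variables (B : comAlgType k) (phi : V -> B).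

Definition mon_lift (m : {cmonom V}) : B :=
  \prod_(v <- finsupp m) phi v ^+ m v.

Lemma mon_liftEw (m : {cmonom V}) (d : {fset V}) : (finsupp m `<=` d)%fset ->
  mon_lift m = \prod_(v <- d) phi v ^+ m v.
Proof.
move=> md; rewrite /mon_lift (big_fset_incl _ md) // => v _.
by rewrite -cmE_eq0 => /eqP ->; rewrite expr0.
Qed.

Fact mon_lift1 : mon_lift mone = 1.
Proof. by rewrite /mon_lift mdom1 big_seq_fset0. Qed.

Fact mon_liftM m1 m2 : mon_lift (mmul m1 m2) = mon_lift m1 * mon_lift m2.
Proof.
rewrite (@mon_liftEw m1 (finsupp m1 `|` finsupp m2)%fset) ?fsubsetUl //.
rewrite (@mon_liftEw m2 (finsupp m1 `|` finsupp m2)%fset) ?fsubsetUr //.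
rewrite -big_split /mon_lift mdomD; apply: eq_bigr => v _.
by rewrite cmM exprD.
Qed.

HB.instance Definition _ := isMultiplicative.Build {cmonom V} B mon_lift
  (mon_liftM, mon_lift1).

Definition free_lift (g : freealg) : B := mmap (in_alg B) mon_lift g.

Lemma free_liftD : {morph free_lift : g h / g + h}.
Proof. exact: raddfD. Qed.

Lemma free_liftB : {morph free_lift : g h / g - h}.
Proof. exact: raddfB. Qed.

Lemma free_liftM : {morph free_lift : g h / g * h}.
Proof. exact: rmorphM. Qed.

Lemma free_lift1 : free_lift 1 = 1.
Proof. exact: rmorph1. Qed.

Lemma free_liftZ c : {morph free_lift : g / c *: g}.
Proof. by move=> g; rewrite /free_lift mmapZ /= mulr_algl. Qed.

Lemma free_lift_gen v : free_lift (freegen v) = phi v.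
Proof.
rewrite /free_lift freegen.unlock mmapU /= scale1r mul1r /mon_lift mdomU big_seq_fset1.
by rewrite cmUU expr1.
Qed.

Fact free_ker0 : free_lift 0 == 0.
Proof. by apply/eqP; apply: raddf0. Qed.

Fact free_kerD u v : free_lift u == 0 -> free_lift v == 0 -> free_lift (u + v) == 0.
Proof. by rewrite free_liftD => /eqP -> /eqP ->; rewrite addr0. Qed.

Fact free_kerM a u : free_lift u == 0 -> free_lift (a * u) == 0.
Proof. by rewrite free_liftM => /eqP ->; rewrite mulr0. Qed.

Definition free_ker : ideal freealg :=
  @Ideal freealg (fun g => free_lift g == 0) free_ker0 free_kerD free_kerM.

Hypothesis phi_linear : linear phi.

Lemma free_lift_rel a b : ideal_gen linear_relation (a - b) ->
  free_lift a = free_lift b.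
Proof.
move=> /(@ideal_gen_min _ _ free_ker) E; apply/eqP; rewrite -subr_eq0 -free_liftB.
apply: E => _ [c [v [w ->]]].
apply/eqP; rewrite free_liftB free_liftD free_liftZ.
by rewrite !free_lift_gen phi_linear subrr.
Qed.

Definition sym_lift (x : sym) : B := fquot_lift free_lift x.

Lemma sym_liftE a : sym_lift (fproj _ a) = free_lift a.
Proof. exact: (fquot_liftE free_lift_rel). Qed.

End FreeLift.

Lemma sym_in_linear : linear sym_in.
Proof.
move=> c v w; rewrite /sym_in -fprojZ -fprojD; apply/fproj_eq.
by apply: ideal_gen_sub; exists c, v, w.
Qed.

HB.instance Definition _ := GRing.isLinear.Build k V sym *:%R sym_in sym_in_linear.

Fact sym_oner_neq0 : (1 : sym) != 0.
Proof.
pose z (_ : V) : k^o := 0.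
have zlin : linear z by move=> c v w; rewrite /z scaler0 addr0.
apply/eqP => E; have : sym_lift z (fproj _ 1) = sym_lift z (fproj _ 0).
  by rewrite fproj0; congr (sym_lift z _).
rewrite !(sym_liftE zlin) free_lift1 => /eqP.
by rewrite [free_lift _ _]raddf0 oner_eq0.
Qed.

HB.instance Definition _ := GRing.PzSemiRing_isNonZero.Build sym sym_oner_neq0.
HB.instance Definition _ := GRing.Lmodule_isLalgebra.Build k sym
  (@fquot_scaleAl k freealg (ideal_gen linear_relation)).
HB.instance Definition _ := GRing.Lalgebra_isComAlgebra.Build k sym.

Section SymLift.
Variables (B : comAlgType k) (phi : {linear V -> B}).

Let sym_liftE' := sym_liftE (@linearP _ _ _ _ phi).

Fact sym_lift_linear : linear (sym_lift phi).
Proof.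
move=> c x y; have [a ->] := fproj_surj x; have [b ->] := fproj_surj y.
by rewrite -fprojZ -fprojD !sym_liftE' free_liftD free_liftZ.
Qed.

Fact sym_lift_monoid : monoid_morphism (sym_lift phi).
Proof.
split; first by rewrite -[RHS](free_lift1 phi) -sym_liftE'.
move=> x y; have [a ->] := fproj_surj x; have [b ->] := fproj_surj y.
by rewrite -fprojM !sym_liftE' free_liftM.
Qed.

HB.instance Definition _ := GRing.isLinear.Build k sym B *:%R (sym_lift phi)
  sym_lift_linear.
HB.instance Definition _ := GRing.isMonoidMorphism.Build sym B (sym_lift phi)
  sym_lift_monoid.

Lemma sym_lift_in v : sym_lift phi (sym_in v) = phi v.
Proof. by rewrite sym_liftE' free_lift_gen. Qed.

End SymLift.

(* Sym(V) is generated by V. *)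
Lemma sym_ind (P : sym -> Prop) : P 0 -> P 1 ->
  (forall c x y, P x -> P y -> P (c *: x + y)) ->
  (forall v x, P x -> P (sym_in v * x)) -> forall x, P x.
Proof.
move=> P0 P1 PD PM x; have [g ->] := fproj_surj x.
have Pmon n (m : {cmonom V}) : mdeg m = n -> P (fproj _ (<< m >> : freealg)).
  elim: n m => [|n IHn] m deg_m; first by rewrite (mdeg_eq0I deg_m).
  have [v mv] : exists v, v \in finsupp m.
    apply/fset0Pn; apply: contra_eqN deg_m => /eqP m0.
    by rewrite mdegE m0 big_seq_fset0.
  pose m' := divcm m (ucm v).
  have Em : m = mmul (ucm v) m'.
    apply/eqP/cmP => w; rewrite cmM divcmE cmU subnKC //.
    by case: eqP => // <-; rewrite lt0n cmE_neq0.
  have -> : (<< m >> : freealg) = freegen v * << m' >>.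
    by rewrite freegen.unlock malgM_def fgmulUU mulr1 -Em.
  rewrite fprojM; apply: PM; apply: IHn.
  by move: deg_m; rewrite Em mdegM mdegU add1n => -[].
have PmonZ c (m : {cmonom V}) : P (fproj _ (<< c *g m >> : freealg)).
  have -> : (<< c *g m >> : freealg) = c *: (<< m >> : freealg).
    by rewrite -[RHS]mul_malgC malgM_def fgmulUU mul1m mulr1.
  have -> : fproj (ideal_gen linear_relation) (c *: (<< m >> : freealg))
      = c *: fproj (ideal_gen linear_relation) (<< m >> : freealg).
    exact: fprojZ.
  by have := PD c _ _ (Pmon _ m erefl) P0; rewrite addr0.
rewrite (monalgE g); elim: (enum_fset _) => [|m s IHs].
  by rewrite big_nil fproj0.
rewrite big_cons fprojD -[X in X + _]scale1r.
exact: PD (PmonZ _ _) IHs.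
Qed.

End SymmetricAlgebra.

Arguments sym_in {k V} v.

Lemma sym_universal (k : fieldType) (V : lmodType k) (B : comAlgType k)
    (phi : {linear V -> B}) :
  exists2 psi : {lrmorphism sym V -> B}, (forall v, psi (sym_in v) = phi v)
    & forall psi' : {lrmorphism sym V -> B},
        (forall v, psi' (sym_in v) = phi v) -> psi' =1 psi.
Proof.
exists (sym_lift phi) => [v|psi' E x]; first exact: sym_lift_in.
elim/sym_ind: x => [||c x y IHx IHy|v x IHx].
- by rewrite !raddf0.
- by rewrite !rmorph1.
- by rewrite !linearP /= IHx IHy.
- by rewrite !rmorphM /= IHx E sym_lift_in.
Qed.

Section GorensteinDuality.
Variable k : fieldType.

Definition duality_pairing (A : comPzRingType) (l : A -> k) (a b : A) : k :=
  l (a * b).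

(* One kernel suffices: the pairing is symmetric. *)
Definition gorenstein_duality (A : comPzRingType) (l : A -> k) : Prop :=
  forall a, (forall b, duality_pairing l a b = 0) -> a = 0.

Variable V : lmodType k.

(* Two factor algebras are equal when their ideals are equal; isomorphic
   quotients by distinct ideals are distinct factor algebras. *)
Record gorenstein_factor := GorensteinFactor {
  factor_ideal : ideal (sym V);
  factor_form : {scalar (fquot factor_ideal)};
  factor_duality : gorenstein_duality factor_form
}.

End GorensteinDuality.

(* Main.v *)
Require Import Defs.
From HB Require Import structures.
From mathcomp Require Import all_boot all_algebra.
From mathcomp Require Import fingroup perm finmap.
From mathcomp Require Import boolp.
From mathcomp.multinomials Require mpoly.

(** A factor algebra [Sym(V)/I] with a duality [l] is encoded by the single
    linear form [L a = l (a mod I)] on [Sym(V)].  The form forgets nothing: [l]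
    is [L] passed to the quotient, and nondegeneracy of the pairing says exactly
    that [I] is the set of [a] with [L (a b) = 0] for all [b].  Conversely the
    annihilator of an arbitrary linear form is an ideal on whose quotient the
    form induces a Gorenstein duality.  So factor algebras with duality
    correspond to linear forms on [Sym(V)], and it remains to match linear
    forms with formal series, through [f_n v = L (v ^+ n) / n!].

    Both directions of this matching rest on Ryser's formula ([ryser]): the
    alternating sum over subsets [S] of [\prod_j \sum_(i in S) a i j] is the
    permanent of [a].

    A form is determined by its values on powers, because for a matrix with
    constant rows the formula reads
    [n! a_1 ... a_n = \sum_S (-1)^(n - |S|) (\sum_(i in S) a_i)^n]
    ([ryser_diag]), and in characteristic zero [n!] can be divided out
    ([form_determined_by_powers]).

    A form exists for every series.  The candidate value on [v_1 ... v_n] is the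
    polarization [\sum_S (-1)^(n - |S|) f_n (\sum_(i in S) v_i)].  It is
    symmetric by construction.  For its multilinearity, write [f_n] on the span
    of finitely many vectors as a combination of products of [n] coordinates
    ([homogeneous_tensor_form]); on each such product the polarization is a
    permanent by Ryser's formula, hence multilinear in the rows
    ([polarization_linear]).  On the diagonal it is [n! f_n v]
    ([polarization_diag]).  Symmetry defines a form on the free commutative
    algebra on the set [V], and multilinearity says that this form kills the
    ideal defining [Sym(V)] ([free_form_ideal]). *)

Set Implicit Arguments.
Unset Strict Implicit.
Unset Printing Implicit Defensive.

Import GRing.Theory.
Local Open Scope ring_scope.

(** * Ryser's formula for the permanent *)

Section Ryser.
Variable R : comNzRingType.

(** Inclusion-exclusion: the sum is the expansion of [\prod_i (1 - [i \notin T])]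
    in which the factor of [i] contributes [1] when [i] is in [S]. *)
Lemma sum_sign_supersets n (T : {set 'I_n}) :
  \sum_(S : {set 'I_n} | T \subset S) (-1) ^+ #|~: S| = (T == setT)%:R :> R.
Proof.
pose F (i : 'I_n) : R := 1; pose G i : R := - (i \notin T)%:R.
transitivity (\prod_i (F i + G i)); last first.
  have [TT|] := eqVneq T setT.
    by rewrite big1 // => i _; rewrite /F /G TT in_setT oppr0 addr0.
  rewrite -subTset => /subsetPn[i _ iT].
  by rewrite (bigD1 i) //= /F /G iT subrr mul0r.
rewrite bigA_distr [RHS](bigID (fun S : {set _} => T \subset S)) /=.
rewrite [X in _ + X]big1 ?addr0 => [|S /subsetPn[i iT iS]]; last first.
  by rewrite (bigD1 i) //= (negPf iS) /G iT oppr0 mul0r.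
apply: eq_bigr => S /subsetP sTS.
rewrite (bigID (fun i => i \in S)) /= big1 ?mul1r => [|i ->//].
rewrite (eq_bigr (fun=> -1)) => [|i iS]; last first.
  by rewrite (negPf iS) /G (contra (sTS i) iS).
by rewrite prodr_const; congr (_ ^+ _); apply: eq_card => i; rewrite inE.
Qed.

(** Expanding the product over maps [g], the coefficient of [\prod_j a (g j) j]
    is the signed number of sets containing the image of [g]; it vanishes
    unless [g] is onto, that is, a permutation. *)
Lemma ryser n (a : 'I_n -> 'I_n -> R) :
  \sum_(S : {set 'I_n}) (-1) ^+ #|~: S| * \prod_j \sum_(i in S) a i j
  = \sum_(s : 'S_n) \prod_j a (s j) j.
Proof.
pose Pi (g : {ffun 'I_n -> 'I_n}) : R := \prod_j a (g j) j.
transitivity (\sum_g Pi g * (injectiveb g)%:R); last first.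
  rewrite (bigID (fun g : {ffun _} => injectiveb g)) /= addrC big1 ?add0r; last first.
    by move=> g /negPf ->; rewrite mulr0.
  rewrite (reindex (@pval _)) /=; last first.
    pose in_Sn := insubd (1%g : 'S_n).
    by exists in_Sn => /= f Uf; first apply: val_inj; apply: insubdK.
  apply: eq_big => [s|s _]; rewrite ?(valP s) // mulr1.
  by apply: eq_bigr => j _; rewrite pvalE.
transitivity (\sum_(S : {set 'I_n}) \sum_(g : {ffun 'I_n -> 'I_n} | g @: setT \subset S)
    Pi g * (-1) ^+ #|~: S|).
  apply: eq_bigr => S _; rewrite -big_distrl mulrC; congr (_ * _).
  rewrite bigA_distr_big; apply: eq_bigl => g.
  apply/ffun_onP/subsetP => [gS _ /imsetP[i _ ->]|gS i]; first exact: gS.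
  by apply: gS; apply: imset_f.
rewrite (exchange_big_dep predT) //=; apply: eq_bigr => g _.
rewrite -big_distrr sum_sign_supersets; congr (_ * (nat_of_bool _)%:R).
(* A self-map of a finite set is onto iff it is injective. *)
rewrite eqEcard subsetT /= cardsT leqNgt -[#|'I_n|]cardsT.
rewrite ltn_neqAle leq_imset_card andbT negbK.
apply/imset_injP/injectiveP => [gI i j|gI i j _ _]; last exact: gI.
by apply: gI; rewrite inE.
Qed.

(** The polarization identity, which expresses a product through [n]-th powers. *)
Lemma ryser_diag n (a : 'I_n -> R) :
  \sum_(S : {set 'I_n}) (-1) ^+ #|~: S| * (\sum_(i in S) a i) ^+ n
  = n`!%:R * \prod_i a i.
Proof.
have expE (x : R) : x ^+ n = \prod_(j < n) x by rewrite prodr_const card_ord.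
rewrite (eq_bigr _ (fun S _ => congr1 _ (expE _))).
rewrite (ryser (fun i _ => a i)) [LHS](eq_bigr (fun=> \prod_i a i)) => [|s _].
  by rewrite sumr_const card_Sn mulr_natl.
by rewrite [RHS](reindex_inj (@perm_inj _ s)).
Qed.

End Ryser.

(** * Homogeneous polynomials as tensors *)

Section TensorForms.
Variable k : fieldType.

(** Homogeneous polynomials of degree [n] in [r] variables, written as
    combinations of words of [n] variables.  The coefficients [C] are not unique,
    but Ryser's formula applies to each word directly, and linear
    substitutions need no multinomial expansion. *)
Definition tensor_form n r (C : {ffun 'I_n -> 'I_r} -> k) (x : 'I_r -> k) : k :=
  \sum_h C h * \prod_j x (h j).

Lemma tensor_form_subst n r s (C : {ffun 'I_n -> 'I_r} -> k)
    (a : 'I_s -> 'I_r -> k) :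
  exists C' : {ffun 'I_n -> 'I_s} -> k, forall y,
    tensor_form C (fun i => \sum_l y l * a l i) = tensor_form C' y.
Proof.
exists (fun g => \sum_h C h * \prod_j a (g j) (h j)) => y.
rewrite /tensor_form; under eq_bigr => h _ do rewrite bigA_distr_bigA big_distrr /=.
rewrite exchange_big /=; apply: eq_bigr => g _; rewrite big_distrl /=.
by apply: eq_bigr => h _; rewrite big_split mulrA mulrAC.
Qed.

Section Polynomials.
Import mpoly.

Lemma mpoly_monomial_prod n r (m : 'X_{1..r}) : mdeg m = n ->
  exists h : {ffun 'I_n -> 'I_r}, forall x : 'I_r -> k,
    \prod_i x i ^+ m i = \prod_j x (h j).
Proof.
move=> mn; pose t := flatten [seq nseq (m i) i | i <- index_enum 'I_r].
have /eqP tn : size t = n.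
  rewrite -mn mdegE -sum1_size big_flatten big_map; apply: eq_bigr => i _.
  by rewrite sum1_size size_nseq.
exists [ffun j => tnth (Tuple tn) j] => x.
under [RHS]eq_bigr => j _ do rewrite ffunE.
rewrite -(big_tuple _ _ (Tuple tn) predT x) /= /t big_flatten big_map.
by apply: eq_bigr => i _; rewrite big_nseq iter_mulr_1.
Qed.

Lemma meval_tensor_form n r (p : {mpoly k[r]}) : p \is n.-homog ->
  exists C : {ffun 'I_n -> 'I_r} -> k, forall x, p.@[x] = tensor_form C x.
Proof.
move=> /dhomogP hp; suff H (s : seq 'X_{1..r}) : {subset s <= msupp p} ->
    exists C : {ffun 'I_n -> 'I_r} -> k, forall x : 'I_r -> k,
      \sum_(m <- s) p@_m * \prod_i x i ^+ m i = tensor_form C x.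
  by have [C HC] := H _ (fun _ => id); exists C => x; rewrite mevalE HC.
elim: s => [|m s IHs] ms.
  by exists (fun=> 0) => x; rewrite big_nil /tensor_form big1 // => h _; rewrite mul0r.
have [|C HC] := IHs; first by move=> u us; rewrite ms // inE us orbT.
have [|h Hh] := @mpoly_monomial_prod n r m; first by rewrite hp // ms // mem_head.
exists (fun g => p@_m * (g == h)%:R + C g) => x.
rewrite big_cons HC Hh /tensor_form; under [RHS]eq_bigr do rewrite mulrDl.
rewrite big_split /=; congr (_ + _).
rewrite [RHS](bigD1 h) //= eqxx mulr1 [X in _ + X]big1 ?addr0 // => g /negPf ->.
by rewrite mulr0 mul0r.
Qed.

Lemma tensor_form_meval n r (C : {ffun 'I_n -> 'I_r} -> k) :
  exists2 p : {mpoly k[r]}, p \is n.-homog & forall x, tensor_form C x = p.@[x].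
Proof.
exists (\sum_h C h *: \prod_j 'X_(h j)) => [|x].
  apply: rpred_sum => h _; apply/dhomogZ.
  have -> : \prod_j 'X_(h j) = 'X_[(\sum_j U_(h j))%MM] :> {mpoly k[r]}.
    by rewrite -mprodXE.
  rewrite dhomogX; apply/eqP.
  rewrite [LHS]mdeg_sum (eq_bigr (fun=> 1%N)) ?sum1_card ?card_ord // => j _.
  exact: mdeg1.
rewrite raddf_sum; apply: eq_bigr => h _ /=.
by rewrite mevalZ rmorph_prod; congr (_ * _); apply: eq_bigr => j _; rewrite /= mevalXU.
Qed.

End Polynomials.

Variable V : lmodType k.

(** A basis is extracted by removing, as long as there is a linear relation, a
    vector that has a nonzero coefficient in it. *)
Lemma free_family_factor m (e : 'I_m -> V) :
  exists r, exists2 b : 'I_r -> V,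
    (forall c : 'I_r -> k, \sum_i c i *: b i = 0 -> forall i, c i = 0)
    & exists a : 'I_m -> 'I_r -> k, forall i, e i = \sum_j a i j *: b j.
Proof.
elim: m e => [|m IHm] e.
  exists 0, e; first by move=> c _ [].
  by exists (fun _ _ => 0) => -[].
have [free_e|] := pselect
    (forall c : 'I_m.+1 -> k, \sum_i c i *: e i = 0 -> forall i, c i = 0).
  exists m.+1, e => //; exists (fun i j => (i == j)%:R) => i.
  rewrite (bigD1 i) //= eqxx scale1r big1 ?addr0 // => j /negPf.
  by rewrite eq_sym => ->; rewrite scale0r.
move=> /existsNP[c /not_implyP[ce0 /existsNP[i0 /eqP ci0]]].
have [r [b free_b [a ea]]] := IHm (fun j => e (lift i0 j)).
exists r, b => //.
exists (fun i l => if unlift i0 i is Some j then a j l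
                   else \sum_j - (c (lift i0 j) / c i0) * a j l) => i.
case: unliftP => [j ->|->]; first exact: ea.
under eq_bigr do rewrite scaler_suml.
rewrite exchange_big /=; apply: (scalerI ci0).
move: ce0; rewrite (bigD1_ord i0) //= => /(canRL (addrK _)) ->.
rewrite sub0r -sumrN scaler_sumr; apply: eq_bigr => j _.
rewrite ea -scaleNr !scaler_sumr; apply: eq_bigr => l _.
by rewrite !scalerA mulrA mulrN mulrCA divff // mulr1.
Qed.

(** Homogeneity speaks of linearly independent families only; expanding the
    vectors of [e] in a basis of their span extends it to all families, which
    is the form in which polarization uses it. *)
Lemma homogeneous_tensor_form n (f : V -> k) : homogeneous_polynomial n f ->
  forall m (e : 'I_m -> V), exists C : {ffun 'I_n -> 'I_m} -> k,
    forall x, f (\sum_i x i *: e i) = tensor_form C x.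
Proof.
move=> hf m e; have [r [b free_b [a ea]]] := free_family_factor e.
have [p /meval_tensor_form[C HC] Hp] := hf r b free_b.
have [C' HC'] := tensor_form_subst C a; exists C' => x.
rewrite -HC' -HC -Hp; congr (f _).
under eq_bigr do rewrite ea scaler_sumr; rewrite exchange_big /=.
apply: eq_bigr => j _; rewrite scaler_suml; apply: eq_bigr => i _.
by rewrite scalerA.
Qed.

End TensorForms.

(** * Polarization *)

Section Polarization.
Variables (k : fieldType) (V : lmodType k) (n : nat) (f : V -> k).

Definition polarization (v : 'I_n -> V) : k :=
  \sum_(S : {set 'I_n}) (-1) ^+ #|~: S| * f (\sum_(i in S) v i).

Lemma polarization_perm (s : 'S_n) (v : 'I_n -> V) :
  polarization (fun i => v (s i)) = polarization v.
Proof.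
rewrite /polarization [RHS](reindex_inj (imset_inj (@perm_inj _ s))) /=.
apply: eq_bigr => S _; congr (_ ^+ _ * f _).
  have /eqP := cardsC S; have /eqP := cardsC (s @: S).
  rewrite card_imset; last exact: perm_inj.
  by move=> /eqP <- /eqP /addnI.
by rewrite big_imset //= => i j _ _; apply: perm_inj.
Qed.

Hypothesis hf : homogeneous_polynomial n f.

(** On a single word of coordinates the polarization is the left-hand side of
    Ryser's formula. *)
Lemma polarization_permanent m (e : 'I_m -> V) :
  exists C : {ffun 'I_n -> 'I_m} -> k, forall a : 'I_n -> 'I_m -> k,
    polarization (fun i => \sum_l a i l *: e l)
    = \sum_h C h * \sum_(s : 'S_n) \prod_j a (s j) (h j).
Proof.
have [C HC] := homogeneous_tensor_form hf e; exists C => a.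
rewrite /polarization.
transitivity (\sum_(S : {set 'I_n}) \sum_h
    C h * ((-1) ^+ #|~: S| * \prod_j \sum_(i in S) a i (h j))).
  apply: eq_bigr => S _; rewrite exchange_big /=.
  under eq_bigr do rewrite -scaler_suml.
  by rewrite HC mulr_sumr; apply: eq_bigr => h _; rewrite mulrCA.
rewrite exchange_big; apply: eq_bigr => h _ /=.
by rewrite -mulr_sumr (ryser (fun i j => a i (h j))).
Qed.

Lemma polarization_diag v : polarization (fun=> v) = n`!%:R * f v.
Proof.
(* Along the line of v, f is c |-> c ^+ n * f v. *)
have [C HC] := homogeneous_tensor_form hf (fun _ : 'I_1 => v).
have fE c : f (c *: v) = c ^+ n * f v.
  have E d : f (d *: v) = d ^+ n * \sum_h C h.
    have := HC (fun=> d); rewrite big_ord1 => ->.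
    rewrite mulr_sumr; apply: eq_bigr => h _.
    by rewrite prodr_const card_ord mulrC.
  by rewrite E -[X in _ * f X]scale1r E expr1n mul1r.
have := ryser_diag (fun _ : 'I_n => 1 : k); rewrite [X in _ = _ * X]big1 // mulr1 => <-.
rewrite mulr_suml; apply: eq_bigr => S _.
by rewrite -mulrA -fE scaler_suml; under [in RHS]eq_bigr do rewrite scale1r.
Qed.

(** All three families are expanded in the [n + 1] vectors [v i], [w i0]: their
    coordinate matrices differ in row [i0] only, and a permanent is linear in
    each row. *)
Lemma polarization_linear i0 c (u v w : 'I_n -> V) :
    (forall i, i != i0 -> u i = v i /\ u i = w i) ->
    u i0 = c *: v i0 + w i0 ->
  polarization u = c * polarization v + polarization w.
Proof.
move=> uvw ui0.
(* The vector w i0 has index ord_max, and v i has index lift ord_max i. *)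
pose e (l : 'I_n.+1) := if unlift ord_max l is Some i then v i else w i0.
(* In row i0 of [a x y] stand the coordinates of x *: v i0 + y *: w i0. *)
pose a (x y : k) (i : 'I_n) (l : 'I_n.+1) : k :=
  if i == i0 then
    (if l == ord_max then y else if l == lift ord_max i0 then x else 0)
  else (l == lift ord_max i)%:R.
have ae x y t : (forall i, i != i0 -> t i = v i) -> t i0 = x *: v i0 + y *: w i0 ->
    t = fun i => \sum_l a x y i l *: e l.
  move=> tv ti0; apply/funext => i; rewrite (bigD1_ord ord_max) //=.
  rewrite /e unlift_none (bigD1 i) //= liftK big1 /a ?addr0; last first.
    move=> j /negPf ji; rewrite !(inj_eq lift_inj) ji.
    rewrite [_ == ord_max]eq_sym (negPf (neq_lift _ _)).
    case: eqP => [ii0|_]; last by rewrite scale0r.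
    by rewrite -ii0 ji scale0r.
  rewrite !(inj_eq lift_inj) !eqxx [lift _ _ == ord_max]eq_sym.
  rewrite !(negPf (neq_lift _ _)).
  have [->|ni] := eqVneq i i0; first by rewrite addrC.
  by rewrite scale0r add0r scale1r tv.
have -> := ae c 1 u (fun i ni => (uvw i ni).1); last by rewrite scale1r.
have -> := ae 1 0 v; rewrite ?scale1r ?scale0r ?addr0 //.
have -> := ae 0 1 w; rewrite ?scale1r ?scale0r ?add0r //; last first.
  by move=> i /uvw[<- <-].
(* In each term of the permanent, exactly one factor comes from row i0. *)
have [C HC] := polarization_permanent e; rewrite !HC mulr_sumr -big_split.
apply: eq_bigr => h _ /=; rewrite mulrCA -mulrDr; congr (_ * _).
rewrite mulr_sumr -big_split.
apply: eq_bigr => s _ /=; pose j0 := (s^-1)%g i0.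
have sj0 : s j0 = i0 by rewrite permKV.
have aE x y : \prod_j a x y (s j) (h j)
    = a x y i0 (h j0) * \prod_(j | j != j0) (h j == lift ord_max (s j))%:R.
  rewrite (bigD1 j0) //= sj0; congr (_ * _).
  by apply: eq_bigr => j /negPf jj0; rewrite /a -sj0 (inj_eq perm_inj) jj0.
rewrite !aE mulrA -mulrDl; congr (_ * _).
rewrite /a eqxx; case: eqP => _; first by rewrite mulr0 add0r.
by case: eqP => _; rewrite ?mulr1 ?mulr0 addr0.
Qed.

End Polarization.

From mathcomp.multinomials Require Import monalg.

(** * Annihilators and forms on quotients *)

Section QuotientForm.
Variables (k : fieldType) (A : comAlgType k) (L : {scalar A}).

Lemma quotient_form_exists (I : ideal A) : (forall a, I a -> L a = 0) ->
  {M : {scalar (fquot I)} | forall a, M (fproj I a) = L a}.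
Proof.
move=> IL; pose M (x : fquot I) : k := fquot_lift L x.
have ME a : M (fproj I a) = L a.
  by apply: fquot_liftE => x y /IL /eqP; rewrite raddfB subr_eq0 => /eqP.
have Mlin : scalar M.
  move=> c x y; have [a ->] := fproj_surj x; have [b ->] := fproj_surj y.
  by rewrite -fprojZ -fprojD !ME linearP.
pose Mmixin := GRing.isLinear.Build k (fquot I) k *%R M Mlin.
pose Mlinear : {scalar (fquot I)} := HB.pack M Mmixin.
by exists Mlinear.
Qed.

Definition annihilator_pred (x : A) : bool := `[< forall y, L (x * y) = 0 >].

Fact annihilator0 : annihilator_pred 0.
Proof. by apply/asboolP => y; rewrite mul0r raddf0. Qed.

Fact annihilatorD u v :
  annihilator_pred u -> annihilator_pred v -> annihilator_pred (u + v).
Proof.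
move=> /asboolP Lu /asboolP Lv; apply/asboolP => y.
by rewrite mulrDl raddfD /= Lu Lv addr0.
Qed.

Fact annihilatorM a u : annihilator_pred u -> annihilator_pred (a * u).
Proof. by move=> /asboolP Lu; apply/asboolP => y; rewrite -mulrA mulrCA Lu. Qed.

Definition annihilator : ideal A := Ideal annihilator0 annihilatorD annihilatorM.

Lemma annihilatorP x : reflect (forall y, L (x * y) = 0) (annihilator x).
Proof. exact: asboolP. Qed.

Lemma annihilator_vanish x : annihilator x -> L x = 0.
Proof. by move=> /annihilatorP/(_ 1); rewrite mulr1. Qed.

End QuotientForm.

(** * The linear form of a formal series *)

(** Linearity in the coefficients holds for every function of the monomial, not
    only for multiplicative ones. *)
Lemma mmap_scalar (k : fieldType) (K : choiceType) (h : K -> k) :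
  scalar (mmap idfun h : {malg k[K]} -> k).
Proof.
move=> c x y; rewrite raddfD /=; congr (_ + _).
rewrite (mmapEw (msuppZ_le c x)) mmapE mulr_sumr; apply: eq_bigr => m _ /=.
by rewrite mcoeffZ mulrA.
Qed.

Section SeriesToForm.
Variables (k : fieldType) (V : lmodType k) (f : formal_series V).

Definition polar_seq (s : seq V) : k :=
  polarization (f (size s)) (fun i : 'I_(size s) => s`_i).

Lemma polar_seqE n (t : n.-tuple V) : polar_seq t = polarization (f n) (tnth t).
Proof.
case: t => s /[dup] /eqP <- sn; congr polarization.
by apply/funext => i; rewrite (tnth_nth 0).
Qed.

Lemma polar_seq_perm (s t : seq V) : perm_eq s t -> polar_seq s = polar_seq t.
Proof.
move=> /(@tuple_permP _ _ _ (in_tuple t))[p ->].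
rewrite -[t in RHS]/(tval (in_tuple t)) !polar_seqE -[RHS](polarization_perm _ p).
by congr polarization; apply/funext => i; rewrite tnth_mktuple.
Qed.

Lemma polar_seq_linear c v w (s : seq V) :
  polar_seq ((c *: v + w) :: s) = c * polar_seq (v :: s) + polar_seq (w :: s).
Proof.
by apply: (polarization_linear (componentP f _) (i0 := ord0)) => // -[[|i] ilt].
Qed.

Lemma polar_seq_nseq n v : polar_seq (nseq n v) = n`!%:R * f n v.
Proof.
rewrite -[nseq n v]/(tval (nseq_tuple n v)) polar_seqE.
rewrite -(polarization_diag (componentP f n)); congr polarization.
by apply/funext => i; rewrite (tnth_nth 0) nth_nseq ltn_ord.
Qed.

(** A word whose product is the monomial [m]; polarizations are symmetric, so
    any order of its letters gives the same value. *)
Definition cmonom_seq (m : {cmonom V}) : seq V :=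
  flatten [seq nseq (m v) v | v <- finsupp m].

Definition seq_cmonom (s : seq V) : {cmonom V} := \big[mmul/mone]_(v <- s) ucm v.

Lemma count_cmonom_seq m v : count_mem v (cmonom_seq m) = m v.
Proof.
rewrite /cmonom_seq count_flatten -map_comp sumnE big_map.
under eq_bigr => w _ do rewrite /= count_nseq.
have [vm|vm] := boolP (v \in finsupp m).
  rewrite (big_fsetD1 v) //= eqxx mul1n big1_fset ?addn0 // => w.
  by rewrite !inE => /andP[/negPf ->].
rewrite big1_fset => [|w wm _]; first by apply/esym/eqP; rewrite cmE_eq0.
by rewrite /=; case: eqP => // wv; rewrite -wv wm in vm.
Qed.

Lemma seq_cmonomE s v : seq_cmonom s v = count_mem v s.
Proof.
rewrite /seq_cmonom; elim: s => [|w s IHs]; first by rewrite big_nil cm1.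
by rewrite big_cons cmM cmU IHs.
Qed.

Lemma cmonom_seqK m : seq_cmonom (cmonom_seq m) = m.
Proof. by apply/eqP/cmP => v; rewrite seq_cmonomE count_cmonom_seq. Qed.

Lemma seq_cmonomK s : perm_eq (cmonom_seq (seq_cmonom s)) s.
Proof. by apply/allP => v _ /=; rewrite count_cmonom_seq seq_cmonomE. Qed.

Definition free_word (s : seq V) : freealg V := \prod_(v <- s) freegen v.

Lemma free_wordE s : free_word s = << seq_cmonom s >>.
Proof.
rewrite /free_word /seq_cmonom; elim: s => [|v s IHs]; first by rewrite !big_nil.
rewrite !big_cons IHs freegen.unlock malgM_def fgmulUU mulr1; reflexivity.
Qed.

(** The form whose value on the monomial [v_1 ... v_n] is the polarization of
    [f_n] at [v_1, ..., v_n]. *)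
Definition free_form : freealg V -> k :=
  mmap idfun (fun m => polar_seq (cmonom_seq m)).

Lemma free_form_linear : scalar free_form.
Proof. exact: mmap_scalar. Qed.

HB.instance Definition _ :=
  GRing.isLinear.Build k (freealg V) k *%R free_form free_form_linear.

Lemma free_form_word s : free_form (free_word s) = polar_seq s.
Proof.
by rewrite free_wordE /free_form mmapU /= mul1r; apply/polar_seq_perm/seq_cmonomK.
Qed.

(** The annihilator of [free_form] is an ideal, so it is enough that it contains
    the defining relations of [Sym(V)]; for a relation multiplied by a monomial,
    this is the linearity of the polarization in one argument. *)
Lemma free_form_ideal x : ideal_gen (@linear_relation k V) x -> free_form x = 0.
Proof.
move=> Ix; apply: annihilator_vanish.
apply: (ideal_gen_min _ Ix) => {x Ix} _ [c [v [w ->]]]; apply/annihilatorP => z.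
rewrite (monalgE z) mulr_sumr raddf_sum big1 // => m _ /=.
have -> : << z@_m *g m >> = z@_m *: free_word (cmonom_seq m).
  by rewrite free_wordE cmonom_seqK -[RHS]mul_malgC malgM_def fgmulUU mul1m mulr1.
have formZ b g : free_form (b *: g) = b * free_form g.
  by have := free_form_linear b g 0; rewrite raddf0 !addr0.
rewrite -scalerAr formZ mulrBl mulrDl -scalerAl raddfB raddfD /= formZ.
have E u : freegen u * free_word (cmonom_seq m) = free_word (u :: cmonom_seq m).
  by rewrite /free_word big_cons.
by rewrite !E !free_form_word polar_seq_linear subrr mulr0.
Qed.

Definition sym_form : {scalar (sym V)} :=
  sval (quotient_form_exists free_form_ideal).

Lemma sym_form_exp n v : sym_form (sym_in v ^+ n) = n`!%:R * f n v.
Proof.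
rewrite -polar_seq_nseq -free_form_word.
rewrite -(svalP (quotient_form_exists free_form_ideal)); congr (sym_form _).
by rewrite /free_word big_nseq iter_mulr_1 fprojX.
Qed.

End SeriesToForm.

(** * The formal series of a linear form *)

Section FormToSeries.
Variables (k : fieldType) (V : lmodType k).

(** Expanding [(\sum_i x_i e_i)^n] into words gives tensor coefficients: the
    values of [L] on products of the [e_i]. *)
Lemma form_exp_homogeneous (L : {scalar (sym V)}) n c :
  homogeneous_polynomial n (fun v => c * L (sym_in v ^+ n)).
Proof.
move=> r e _.
have [p hp Hp] := tensor_form_meval (fun h : {ffun 'I_n -> 'I_r} =>
  c * L (\prod_j sym_in (e (h j)))).
exists p => // x; rewrite -Hp /tensor_form raddf_sum /=.
under eq_bigr do rewrite linearZ /=.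
have -> (y : sym V) : y ^+ n = \prod_(j < n) y by rewrite prodr_const card_ord.
rewrite bigA_distr_bigA raddf_sum mulr_sumr; apply: eq_bigr => h _ /=.
by rewrite scaler_prod linearZ /= [in RHS]mulrAC mulrA mulrAC.
Qed.

Hypothesis char0 : [pchar k] =i pred0.

Lemma natf_fact_neq0 n : n`!%:R != 0 :> k.
Proof. by have /pcharf0P -> := char0; rewrite -lt0n fact_gt0. Qed.

(** The algebra is spanned by products of vectors, and [n!] times a product of
    [n] vectors is a signed sum of [n]-th powers by [ryser_diag]. *)
Lemma form_determined_by_powers (L M : {scalar (sym V)}) :
  (forall n v, L (sym_in v ^+ n) = M (sym_in v ^+ n)) -> L =1 M.
Proof.
move=> LM x.
have LMprod (s : seq V) : L (\prod_(v <- s) sym_in v) = M (\prod_(v <- s) sym_in v).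
  rewrite (big_nth 0) big_mkord; apply: (mulfI (natf_fact_neq0 (size s))).
  have E (N : {scalar (sym V)}) a m : m%:R * N a = N (m%:R * a).
    by rewrite !mulr_natl raddfMn.
  rewrite !E -ryser_diag !raddf_sum; apply: eq_bigr => S _ /=.
  have <- : sym_in (\sum_(i in S) s`_i) = \sum_(i in S) sym_in s`_i :> sym V.
    by rewrite raddf_sum.
  by rewrite -signr_odd mulr_sign; case: odd; rewrite ?raddfN /= LM.
(* sym_ind adds vectors on the left of x, which a prefix word s absorbs. *)
suff : forall s : seq V,
    L ((\prod_(v <- s) sym_in v) * x) = M ((\prod_(v <- s) sym_in v) * x).
  by move=> /(_ [::]); rewrite big_nil !mul1r.
elim/sym_ind: x => [||c x y IHx IHy|v x IHx] s.
- by rewrite mulr0 !raddf0.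
- by rewrite mulr1.
- have NZ (N : {scalar (sym V)}) b u w : N (b *: u + w) = b * N u + N w.
    exact: linearP.
  rewrite mulrDr -scalerAr (NZ L) (NZ M).
  exact: (congr2 (fun a b => c * a + b) (IHx s) (IHy s)).
- by have := IHx (v :: s); rewrite big_cons -mulrA mulrCA.
Qed.

End FormToSeries.

(** * Factor algebras with duality as linear forms *)

Section FormFactor.
Variables (k : fieldType) (V : lmodType k) (L : {scalar (sym V)}).

Definition annihilator_form : {scalar (fquot (annihilator L))} :=
  sval (quotient_form_exists (@annihilator_vanish _ _ L)).

Lemma annihilator_formE a : annihilator_form (fproj _ a) = L a.
Proof. exact: (svalP (quotient_form_exists (@annihilator_vanish _ _ L))). Qed.

Lemma annihilator_duality : gorenstein_duality annihilator_form.
Proof.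
move=> x; have [a ->] := fproj_surj x => La; rewrite -(fproj0 (annihilator L)).
apply/fproj_eq; rewrite subr0; apply/annihilatorP => y.
by have := La (fproj _ y); rewrite /duality_pairing -fprojM annihilator_formE.
Qed.

Definition form_factor : gorenstein_factor V := GorensteinFactor annihilator_duality.

End FormFactor.

Lemma ideal_ext (R : comNzRingType) (I J : ideal R) : I =1 J -> I = J.
Proof.
case: I J => [I I0 ID IM] [J J0 JD JM] /= /funext IJ; move: J0 JD JM.
by rewrite -IJ => J0 JD JM; congr Ideal; apply: Prop_irrelevance.
Qed.

Lemma scalar_ext (k : fieldType) (U : lmodType k) (f g : {scalar U}) : f =1 g -> f = g.
Proof.
case: f g => [f [[fD] [fZ]]] [g [[gD] [gZ]]] /= /funext fg.
move: gD gZ; rewrite -fg => gD gZ.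
by rewrite (Prop_irrelevance gD fD) (Prop_irrelevance gZ fZ).
Qed.

Lemma series_ext (k : fieldType) (V : lmodType k) (f g : formal_series V) :
  (forall n, f n =1 g n) -> f = g.
Proof.
move=> fg; have {fg} : component f = component g by apply/funext => n; apply/funext.
case: f g => [f hf] [g hg] /= fg; move: hg; rewrite -fg => hg.
by congr FormalSeries; apply: Prop_irrelevance.
Qed.

Section FactorToForm.
Variables (k : fieldType) (V : lmodType k).

Definition pullback_form (A : gorenstein_factor V) (x : sym V) : k :=
  factor_form A (fproj (factor_ideal A) x).

Fact pullback_form_linear A : scalar (pullback_form A).
Proof. by move=> c x y; rewrite /pullback_form fprojD fprojZ linearP. Qed.

HB.instance Definition _ A := GRing.isLinear.Build k (sym V) k *%R
  (pullback_form A) (pullback_form_linear A).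

(** Nondegeneracy of the duality makes the ideal recoverable from the form. *)
Lemma factor_idealP A x :
  factor_ideal A x <-> forall y, pullback_form A (x * y) = 0.
Proof.
case: A => I l dual; rewrite /pullback_form /=; split=> [Ix y|Lx].
  have /fproj_eq -> : I (x * y - 0) by rewrite subr0 mulrC; apply: idealM.
  by rewrite fproj0 raddf0.
rewrite -[x]subr0; apply/fproj_eq; rewrite fproj0; apply: dual => b.
by have [y ->] := fproj_surj b; rewrite /duality_pairing -fprojM.
Qed.

Lemma pullback_form_inj (A B : gorenstein_factor V) :
  pullback_form A =1 pullback_form B -> A = B.
Proof.
move=> AB.
have : factor_ideal A = factor_ideal B.
  apply: ideal_ext => x; apply/idP/idP => /factor_idealP Lx; apply/factor_idealP => y.
    by rewrite -AB.
  by rewrite AB.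
case: A B AB => [I l ldual] [J m mdual] AB /= IJ; move: m mdual AB.
case: J / IJ => m mdual AB.
have lm : l = m.
  by apply: scalar_ext => x; have [a ->] := fproj_surj x; apply: AB.
by case: m / lm mdual {AB} => mdual; congr GorensteinFactor; apply: Prop_irrelevance.
Qed.

Definition factor_series (A : gorenstein_factor V) : formal_series V :=
  FormalSeries (fun n => form_exp_homogeneous (pullback_form A) n n`!%:R^-1).

End FactorToForm.

Theorem corollary3p16 (k : fieldType) (V : lmodType k)
    (char0 : [pchar k] =i pred0) :
  exists Phi : gorenstein_factor V -> formal_series V,
    bijective Phi /\
    forall (A : gorenstein_factor V) (n : nat) (v : V),
      Phi A n v = (n`!%:R)^-1 * factor_form A (fproj (factor_ideal A) (sym_in v) ^+ n).
Proof.
exists (@factor_series k V); split; last first.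
  by move=> A n v; rewrite /= /pullback_form fprojX.
exists (fun f => form_factor (sym_form f)) => [A|f].
  apply: pullback_form_inj => x.
  rewrite [LHS]/pullback_form /= annihilator_formE; move: x.
  apply: (form_determined_by_powers char0) => n v.
  by rewrite sym_form_exp /= mulrA divff ?mul1r // natf_fact_neq0.
apply: series_ext => n v; rewrite /= /pullback_form /= annihilator_formE.
by rewrite sym_form_exp mulrA mulVf ?mul1r // natf_fact_neq0.
Qed.
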